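(* Let $A\in\mathcal{C}^{n\times n}$ be diagonalizable with eigenvalues $\nu_1,\dots,\nu_n\in\mathcal{R}$ (with multiplicity) that are at most finite and satisfy $$1=\nu_1[0]>|\nu_2[0]|\ge\dots\ge|\nu_n[0]|.$$ Let $\mathbf x\in\mathcal{C}^n$ be written as $\mathbf x=\mathbf w_1+\dots+\mathbf w_n$ with $A\mathbf w_j=\nu_j\mathbf w_j$, and assume (i) all $\mathbf w_j$ have at most finite entries, (ii) $\mathbf w_1[0]\neq\mathbf 0$, and (iii) there is a unique index $i_0$ with $|\mathbf w_1^{i_0}[0]|=\max_i|\mathbf w_1^i[0]|$. Then for $\mathbf x_k:=A^k\mathbf x$, $$\frac{\mathbf x_k}{\|\mathbf x_k\|_{\max}}\xrightarrow{wk}\frac{\mathbf w_1}{\|\mathbf w_1\|_{\max}}.$$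
   Context: The Levi-Civita field $\mathcal{R}$ (resp. $\mathcal{C}$) is the set of functions $a:\mathbb Q\to\mathbb R$ (resp. $\mathbb C$) with left-finite support (for every $r\in\mathbb Q$ only finitely many $q<r$ with $a(q)\ne0$), written $a[q]:=a(q)$; addition is pointwise, multiplication is $(ab)[q]=\sum_{q_1+q_2=q}a[q_1]b[q_2]$; $\mathcal{R}$ is a real closed ordered field ($a\succ b$ iff $(a-b)[\lambda(a-b)]>0$) and $\mathcal{C}=\mathcal{R}(i)$ is algebraically closed. $\lambda(a)=\min\{q:a[q]\ne0\}$ ($\lambda(0)=+\infty$); $a$ is at most finite if $\lambda(a)\ge0$. Absolute value: on $\mathcal{R}$, $|a|=a$ if $a\succeq0$ and $-a$ otherwise; on $\mathcal{C}$, $|a+ib|=\sqrt{a^2+b^2}$ for $a,b\in\mathcal{R}$. For $r\in\mathbb Q$, $\|a\|_r:=\sup_{q\le r}|a[q]|\in\mathbb R$. Weak convergence $a_n\xrightarrow{wk}a$: for every real $r>0$ there is $N_0$ with $\|a_n-a\|_{1/r}<r$ for all $n>N_0$. For vectors, weak convergence is coordinatewise, $\mathbf x[0]:=(\mathbf x^1[0],\dots,\mathbf x^n[0])\in\mathbb C^n$, and $\|\mathbf x\|_{\max}=\max_i|\mathbf x^i|$ (maximum w.r.t. the order of $\mathcal{R}$). *)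

(* Defs.v *)
From HB Require Import structures.
From mathcomp Require Import all_boot all_order all_algebra.
From mathcomp Require Import all_classical all_reals.
From mathcomp Require Import complex.
From Stdlib Require Import ClassicalEpsilon.

Set Implicit Arguments.
Unset Strict Implicit.
Unset Printing Implicit Defensive.
Import Order.TTheory GRing.Theory Num.Theory.
Local Open Scope classical_set_scope.
Local Open Scope ring_scope.

(* Levi-Civita numbers, represented as raw functions  a : rat -> K  where    *)
(* K = R (for the real field  \mathcal R) or K = R[i] (for \mathcal C).      *)
(* a q  is the coefficient  a[q].  Membership in the Levi-Civita field is    *)
(* the predicate [left_finite] below, imposed as hypotheses where needed.    *)

Section LeviCivita.

Definition left_finite (K : zmodType) (a : rat -> K) : Prop :=
  forall r : rat, finite_set [set q : rat | q < r /\ a q != 0].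

Definition at_most_finite (K : zmodType) (a : rat -> K) : Prop :=
  forall q : rat, q < 0 -> a q = 0.

Definition lc_zero (K : zmodType) : rat -> K := fun _ => 0.
Definition lc_one (K : pzRingType) : rat -> K :=
  fun q => if q == 0 then 1 else 0.
Definition lc_add (K : zmodType) (a b : rat -> K) : rat -> K :=
  fun q => a q + b q.
Definition lc_opp (K : zmodType) (a : rat -> K) : rat -> K :=
  fun q => - a q.
Definition lc_sub (K : zmodType) (a b : rat -> K) : rat -> K :=
  fun q => a q - b q.

(* (ab)[q] = sum_{q1 + q2 = q} a[q1] b[q2]; the sum has finite support when
   a and b are left-finite (finitely supported sum of mathcomp-analysis). *)
Definition lc_mul (K : pzRingType) (a b : rat -> K) : rat -> K :=
  fun q => \sum_(p \in [set: rat]) (a p * b (q - p)).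

Variable R : realType.

Definition lc_RC (a : rat -> R) : rat -> R[i] := fun q => (a q)%:C%C.

Definition lc_pos (a : rat -> R) : Prop :=
  exists q : rat, 0 < a q /\ forall p : rat, p < q -> a p = 0.
Definition lc_lt (a b : rat -> R) : Prop := lc_pos (lc_sub b a).
Definition lc_le (a b : rat -> R) : Prop := a = b \/ lc_lt a b.

Definition lc_absR (a : rat -> R) : rat -> R :=
  if `[< lc_le (lc_zero R) a >] then a else lc_opp a.

Definition lc_sqrt (c : rat -> R) : rat -> R :=
  epsilon (inhabits (lc_zero R))
    (fun s => left_finite s /\ lc_le (lc_zero R) s /\ lc_mul s s = c).

Definition lc_re (z : rat -> R[i]) : rat -> R := fun q => complex.Re (z q).
Definition lc_im (z : rat -> R[i]) : rat -> R := fun q => complex.Im (z q).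

Definition lc_absC (z : rat -> R[i]) : rat -> R :=
  lc_sqrt (lc_add (lc_mul (lc_re z) (lc_re z)) (lc_mul (lc_im z) (lc_im z))).

Definition lc_inv (a : rat -> R[i]) : rat -> R[i] :=
  epsilon (inhabits (lc_zero R[i]))
    (fun b => left_finite b /\ lc_mul a b = lc_one R[i]).

Definition lc_vec (m : nat) := 'I_m -> rat -> R[i].
Definition lc_mat (m : nat) := 'I_m -> 'I_m -> rat -> R[i].

Definition lc_maxnorm (m : nat) (x : lc_vec m) : rat -> R :=
  epsilon (inhabits (lc_zero R))
    (fun M => (exists i, M = lc_absC (x i)) /\
              forall i, lc_le (lc_absC (x i)) M).

Definition lc_vscale (m : nat) (c : rat -> R[i]) (x : lc_vec m) : lc_vec m :=
  fun i => lc_mul c (x i).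
Definition lc_mv (m : nat) (A : lc_mat m) (x : lc_vec m) : lc_vec m :=
  fun i q => \sum_(j < m) lc_mul (A i j) (x j) q.
Definition lc_mm (m : nat) (A B : lc_mat m) : lc_mat m :=
  fun i j q => \sum_(k < m) lc_mul (A i k) (B k j) q.
Definition lc_idmx (m : nat) : lc_mat m :=
  fun i j => if i == j then lc_one R[i] else lc_zero R[i].

Definition lc_diagonalizable (m : nat) (A : lc_mat m) (nu : 'I_m -> rat -> R)
  : Prop :=
  exists P Q : lc_mat m,
    (forall i j, left_finite (P i j)) /\ (forall i j, left_finite (Q i j)) /\
    lc_mm P Q = (@lc_idmx m) /\ lc_mm Q P = (@lc_idmx m) /\
    lc_mm A P = (fun i j => lc_mul (P i j) (lc_RC (nu j))).

Definition lc_seminorm (a : rat -> R[i]) (s : R) : R :=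
  sup [set complex.Re `|a q| | q in [set q : rat | ratr q <= s]].

Definition lc_wk_cvg (u : nat -> rat -> R[i]) (a : rat -> R[i]) : Prop :=
  forall r : R, 0 < r -> exists N0 : nat,
    forall k : nat, (N0 < k)%N -> lc_seminorm (lc_sub (u k) a) r^-1 < r.

Definition lc_vec_wk_cvg (m : nat) (u : nat -> lc_vec m) (a : lc_vec m)
  : Prop := forall i : 'I_m, lc_wk_cvg (fun k => u k i) (a i).

End LeviCivita.

(* Main.v *)
Require Import Defs.
From HB Require Import structures.
From mathcomp Require Import all_boot all_order all_algebra.
From mathcomp Require Import all_classical all_reals.
From mathcomp Require Import complex ring lra.
From mathcomp Require Import topology normedtype sequences.
Set Implicit Arguments.
Unset Strict Implicit.
Unset Printing Implicit Defensive.
Import Order.TTheory GRing.Theory Num.Theory numFieldNormedType.Exports.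
Local Open Scope classical_set_scope.
Local Open Scope ring_scope.

(** Call a sequence of at most finite Levi-Civita numbers tame if the supports of
its terms lie in one left-finite set and every coefficient converges; such a
sequence converges weakly to its coefficientwise limit.  Tame sequences, together
with their limits, are Levi-Civita numbers over the ring of convergent complex
sequences, and evaluation at [k] and at infinity are ring morphisms.  Over any
commutative ring, an at most finite number is invertible (resp. has a square root)
as soon as its coefficient at [0] is invertible (resp. is an invertible square, and
[2] is invertible), because contractions for the valuation have fixed points.
Hence inverses and absolute values of tame sequences are tame, and no estimate on
their coefficients is needed.

Write [A^k x = nu_1^k y_k] with [y_k = w_1 + sum_(j > 1) mu_j^k w_j] and
[mu_j = nu_j / nu_1].  With [mu_j = m + e], [|m| < 1] and [e] infinitesimal,
[mu_j^k] is the sum of the [binomial(k, i) m^(k-i) e^i]; the sequences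
[k |-> binomial(k, i) m^(k-i)] tend to [0], so [k |-> mu_j^k] is tame with limit
[0], and [y_k] is tame with limit [w_1].  For large [k] the maximum norm of [y_k]
is attained at [i0] alone, as one sees on the coefficients at [0]; so normalising
is continuous along [y_k], and it cancels the factor [nu_1^k], which need not
converge. *)

Lemma left_finite_seq (K : zmodType) (a : rat -> K) (r : rat) :
  left_finite a ->
  exists2 s : seq rat, uniq s & forall q, q <= r -> a q != 0 -> q \in s.
Proof.
move=> /(_ (r + 1)) /finite_seqP[s supp_s].
exists (undup s); rewrite ?undup_uniq // => q qr aq.
have : [set` s] q by rewrite -supp_s /=; split=> //; lra.
by rewrite /= mem_undup.
Qed.

Lemma seq_left_finite (K : zmodType) (a : rat -> K) :
  (forall r, exists s : seq rat, forall q, q < r -> a q != 0 -> q \in s) ->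
  left_finite a.
Proof.
move=> supp_a r; have [s supp_s] := supp_a r.
by apply: (@sub_finite_set _ _ [set` s]) (finite_seq s) => q []; apply: supp_s.
Qed.

Lemma left_finite_first (K : zmodType) (a : rat -> K) (r : rat) :
  left_finite a -> a r != 0 ->
  exists2 l, a l != 0 & forall q, a q != 0 -> l <= q.
Proof.
move=> fa ar; have [s _ supp_s] := left_finite_seq r fa.
pose l := \big[Num.min/r]_(p <- s | a p != 0) p.
have le_lr : l <= r by apply: bigmin_le_id.
exists l; first by rewrite /l; elim/big_rec: _ => // p m ap am; case: leP.
move=> q aq; have [leql|/ltW//] := leP q l.
apply: (ge_bigmin_seq r q (fun p => a p != 0) id) => //.
by rewrite supp_s // (le_trans leql).
Qed.

Lemma left_finite_lbound (K : zmodType) (a : rat -> K) :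
  left_finite a -> exists l, forall q, a q != 0 -> l <= q.
Proof.
move=> fa; have [[r ar]|a0] := pselect (exists r, a r != 0).
  by have [l _ lb_l] := left_finite_first fa ar; exists l.
by exists 0 => q aq; case: a0; exists q.
Qed.

(** * The product of left-finite functions *)

Section Convolution.
Variable K : comPzRingType.
Implicit Types a b c : rat -> K.

Lemma lc_mul_shift_seq a b q r (s : seq rat) : uniq s ->
  (forall p, a (p - r) != 0 -> b (q - p) != 0 -> p \in s) ->
  lc_mul a b (q - r) = \sum_(p <- s) a (p - r) * b (q - p).
Proof.
move=> us supp_s; rewrite /lc_mul (reindex_fsbigT (fun p => p - r)) /=; last first.
  by exists (fun p => p + r) => p; lra.
have shiftE p : q - r - (p - r) = q - p by lra.
under eq_fsbigr do rewrite shiftE.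
rewrite (fsbigE s) //=; first by under eq_bigl do rewrite in_setT.
move=> p _; apply: contraNeq => abp; apply: supp_s; apply: contra_neq abp => ->.
  by rewrite mul0r.
by rewrite mulr0.
Qed.

Lemma lc_mul_seq a b q (s : seq rat) : uniq s ->
  (forall p, a p != 0 -> b (q - p) != 0 -> p \in s) ->
  lc_mul a b q = \sum_(p <- s) a p * b (q - p).
Proof.
move=> us supp_s; rewrite -[q in LHS]subr0 (lc_mul_shift_seq us).
  by apply: eq_bigr => p _; rewrite subr0.
by move=> p; rewrite subr0; apply: supp_s.
Qed.

Lemma lc_mul_supp a b q : left_finite a -> left_finite b ->
  exists2 s : seq rat, uniq s &
    forall p, a p != 0 -> b (q - p) != 0 -> p \in s.
Proof.
move=> fa fb; have [lb b_ge] := left_finite_lbound fb.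
have [s us supp_s] := left_finite_seq (q - lb) fa.
by exists s => // p ap /b_ge lebq; apply: supp_s => //; lra.
Qed.

Lemma lc_mul_neq0 a b q :
  lc_mul a b q != 0 -> exists2 p, a p != 0 & b (q - p) != 0.
Proof.
move=> /(@fsbigN1 _ _ _ _ _ setT (fun x y => a y * b (x - y)))[p _ abp]; exists p.
  by apply: contra_neq abp => ->; rewrite mul0r.
by apply: contra_neq abp => ->; rewrite mulr0.
Qed.

Lemma lc_mul_lbound a b l m :
  (forall p, a p != 0 -> l <= p) -> (forall p, b p != 0 -> m <= p) ->
  forall q, lc_mul a b q != 0 -> l + m <= q.
Proof.
move=> a_ge b_ge q /lc_mul_neq0[p ap bqp].
by rewrite -[q](subrKC p) lerD ?a_ge ?b_ge.
Qed.

Lemma lc_mulC a b : lc_mul a b = lc_mul b a.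
Proof.
apply/funext => q; rewrite /lc_mul (reindex_fsbigT (fun p => q - p)); last first.
  by exists (fun p => q - p) => p; rewrite subKr.
by apply: eq_fsbigr => p _; rewrite subKr mulrC.
Qed.

Lemma left_finite_mul a b :
  left_finite a -> left_finite b -> left_finite (lc_mul a b).
Proof.
move=> fa fb; apply: seq_left_finite => r.
have [la a_ge] := left_finite_lbound fa; have [lb b_ge] := left_finite_lbound fb.
have [s _ supp_s] := left_finite_seq (r - lb) fa.
have [t _ supp_t] := left_finite_seq (r - la) fb.
exists [seq x + y | x <- s, y <- t] => q ltqr /lc_mul_neq0[p ap bqp].
apply/allpairsP; exists (p, q - p); rewrite subrKC.
have := a_ge _ ap; have := b_ge _ bqp => leb lea.
by split=> //=; [apply: supp_s|apply: supp_t] => //; lra.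
Qed.

Lemma lc_mulDl a b c : left_finite a -> left_finite b -> left_finite c ->
  lc_mul (a + b) c = lc_mul a c + lc_mul b c.
Proof.
move=> fa fb fc; apply/funext => q.
have [s _ supp_s] := lc_mul_supp q fa fc.
have [t _ supp_t] := lc_mul_supp q fb fc.
have uniq_st : uniq (undup (s ++ t)) by exact: undup_uniq.
rewrite -[RHS]/(lc_mul a c q + lc_mul b c q) !(lc_mul_seq uniq_st).
- by rewrite -big_split; apply: eq_bigr => p _; apply: mulrDl.
- by move=> p bp cqp; rewrite mem_undup mem_cat supp_t ?orbT.
- by move=> p ap cqp; rewrite mem_undup mem_cat supp_s.
- move=> p abp cqp; rewrite mem_undup mem_cat.
  have [ap|ap] := eqVneq (a p) 0; last by rewrite supp_s.
  by rewrite supp_t ?orbT //; rewrite -[(a + b) p]/(a p + b p) ap add0r in abp.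
Qed.

(* Both sides are the sum of [a r * b (p - r) * c (q - p)] over [r] and [p], which
range over finite sets once [q] is fixed. *)
Lemma lc_mulA a b c : left_finite a -> left_finite b -> left_finite c ->
  lc_mul a (lc_mul b c) = lc_mul (lc_mul a b) c.
Proof.
move=> fa fb fc; apply/funext => q.
have [la a_ge] := left_finite_lbound fa; have [lb b_ge] := left_finite_lbound fb.
have [lc c_ge] := left_finite_lbound fc.
have [s us supp_s] := left_finite_seq (q - lb - lc) fa.
have [t _ supp_t] := left_finite_seq (q - la - lc) fb.
pose u := undup [seq x + y | x <- s, y <- t].
have uniq_u : uniq u by exact: undup_uniq.
have mem_su p r : a r != 0 -> b (p - r) != 0 -> c (q - p) != 0 -> r \in s /\ p \in u.
  move=> ar bpr cqp; have := a_ge _ ar; have := b_ge _ bpr; have := c_ge _ cqp.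
  move=> lec leb lea; have rs : r \in s by apply: supp_s => //; lra.
  split=> //; rewrite mem_undup; apply/allpairsP; exists (r, p - r).
  by split=> //=; [apply: supp_t => //; lra|rewrite subrKC].
transitivity (\sum_(r <- s) \sum_(p <- u) a r * (b (p - r) * c (q - p))).
  rewrite (lc_mul_seq us) => [|r ar /(lc_mul_lbound b_ge c_ge)]; last first.
    by move=> lebc; apply: supp_s => //; lra.
  apply: eq_bigr => r _; rewrite -mulr_sumr.
  have [->|ar] := eqVneq (a r) 0; first by rewrite !mul0r.
  by rewrite (lc_mul_shift_seq uniq_u) // => p bpr cqp; case: (mem_su p r).
rewrite exchange_big /= (lc_mul_seq uniq_u); last first.
  by move=> p /lc_mul_neq0[r ar bpr] cqp; case: (mem_su p r).
apply: eq_bigr => p _; under eq_bigr do rewrite mulrA; rewrite -mulr_suml.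
have [->|cqp] := eqVneq (c (q - p)) 0; first by rewrite !mulr0.
by rewrite (lc_mul_seq us) // => r ar bpr; case: (mem_su p r).
Qed.

Definition left_finite_pred : {pred rat -> K} :=
  [pred a : rat -> K | `[< left_finite a >]].

Fact left_finite_zmod_closed : zmod_closed left_finite_pred.
Proof.
split; first by apply/asboolP/seq_left_finite => r; exists [::] => q _ /eqP.
move=> a b /asboolP fa /asboolP fb; apply/asboolP/seq_left_finite => r.
have [s _ supp_s] := left_finite_seq r fa; have [t _ supp_t] := left_finite_seq r fb.
exists (s ++ t) => q /ltW leqr abq; rewrite mem_cat.
have [aq|/(supp_s _ leqr)-> //] := eqVneq (a q) 0.
rewrite supp_t ?orbT //; apply: contra_neq abq => bq.
by rewrite -[LHS]/(a q - b q) aq bq subr0.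
Qed.
HB.instance Definition _ :=
  GRing.isZmodClosed.Build (rat -> K) left_finite_pred left_finite_zmod_closed.

Definition lc_single (p : rat) (z : K) : rat -> K :=
  fun q => if q == p then z else 0.

Lemma left_finite_single p z : left_finite (lc_single p z).
Proof.
apply: seq_left_finite => r; exists [:: p] => q _; rewrite inE /lc_single.
by case: (q == p) => //; rewrite eqxx.
Qed.

Lemma lc_mul_single p z a q : lc_mul (lc_single p z) a q = z * a (q - p).
Proof.
rewrite (@lc_mul_seq _ _ _ [:: p]) //; first by rewrite big_seq1 /lc_single eqxx.
by move=> x; rewrite inE /lc_single; case: (x == p) => //; rewrite eqxx.
Qed.

End Convolution.

(** * Levi-Civita numbers over a commutative ring *)

Record LC (K : comPzRingType) :=
  MkLC { lcoef :> rat -> K; _ : lcoef \in @left_finite_pred K }.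
HB.instance Definition _ (K : comPzRingType) := [isSub for @lcoef K].
HB.instance Definition _ (K : comPzRingType) := [Choice of LC K by <:].
HB.instance Definition _ (K : comPzRingType) := [SubChoice_isSubZmodule of LC K by <:].

Section LCRing.
Variable K : comPzRingType.
Implicit Types a b c : LC K.

Lemma lcoef_left_finite a : left_finite a.
Proof. by case: a => a /= /asboolP. Qed.

Definition toLC (f : rat -> K) (ff : left_finite f) : LC K := MkLC (asboolT ff).

Lemma LC_ext a b : (forall q, a q = b q) -> a = b.
Proof. by move=> eq_ab; apply/val_inj/funext. Qed.

Definition LCmul a b :=
  toLC (left_finite_mul (lcoef_left_finite a) (lcoef_left_finite b)).
Definition LCsingle p z := toLC (left_finite_single p (z : K)).

Fact LCmulA : associative LCmul.
Proof. by move=> a b c; apply/val_inj/lc_mulA; exact: lcoef_left_finite. Qed.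
Fact LCmulC : commutative LCmul.
Proof. by move=> a b; apply/val_inj/lc_mulC. Qed.
Fact LCmul1 : left_id (LCsingle 0 1) LCmul.
Proof. by move=> a; apply/LC_ext => q; rewrite /= lc_mul_single mul1r subr0. Qed.
Fact LCmulDl : left_distributive LCmul +%R.
Proof. by move=> a b c; apply/val_inj/lc_mulDl; exact: lcoef_left_finite. Qed.
HB.instance Definition _ :=
  GRing.Zmodule_isComPzRing.Build (LC K) LCmulA LCmulC LCmul1 LCmulDl.

Lemma lcoefD a b q : (a + b) q = a q + b q. Proof. by []. Qed.
Lemma lcoefB a b q : (a - b) q = a q - b q. Proof. by []. Qed.
Lemma lcoef0 q : (0 : LC K) q = 0. Proof. by []. Qed.
Lemma lcoef_sum I (s : seq I) (P : pred I) (F : I -> LC K) q :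
  (\sum_(i <- s | P i) F i) q = \sum_(i <- s | P i) F i q.
Proof. by elim/big_rec2: _ => // i x y _ <-. Qed.
Lemma lcoefM a b : lcoef (a * b) = lc_mul a b. Proof. by []. Qed.
Lemma lcoef_singleM p z a q : (LCsingle p z * a) q = z * a (q - p).
Proof. exact: lc_mul_single. Qed.

Definition LCconst (z : K) : LC K := LCsingle 0 z.

Lemma lcoef_const z q : LCconst z q = if q == 0 then z else 0.
Proof. by []. Qed.

Lemma lcoef_constM z a q : (LCconst z * a) q = z * a q.
Proof. by rewrite lcoef_singleM subr0. Qed.

Fact LCconst_is_zmod_morphism : zmod_morphism LCconst.
Proof.
move=> y z; apply: LC_ext => q; rewrite lcoefB !lcoef_const.
by case: eqP; rewrite ?subr0.
Qed.
Fact LCconst_is_monoid_morphism : monoid_morphism LCconst.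
Proof.
split=> // y z; apply: LC_ext => q.
by rewrite lcoef_constM !lcoef_const; case: eqP; rewrite ?mulr0.
Qed.
HB.instance Definition _ :=
  GRing.isZmodMorphism.Build K (LC K) LCconst LCconst_is_zmod_morphism.
HB.instance Definition _ :=
  GRing.isMonoidMorphism.Build K (LC K) LCconst LCconst_is_monoid_morphism.

Lemma lcoef1 q : (1 : LC K) q = if q == 0 then 1 else 0. Proof. by []. Qed.

End LCRing.

Section Map.
Variables (K L : comPzRingType) (f : {additive K -> L}).

Lemma left_finite_comp (a : LC K) : left_finite (f \o a).
Proof.
apply: seq_left_finite => r.
have [s _ supp_s] := left_finite_seq r (lcoef_left_finite a).
exists s => q /ltW leqr fa; apply: supp_s => //.
by apply: contra_neq fa => /= ->; rewrite raddf0.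
Qed.

Definition LCmap (a : LC K) : LC L := toLC (left_finite_comp a).

Lemma lcoef_map a q : LCmap a q = f (a q). Proof. by []. Qed.

Fact LCmap_is_zmod_morphism : zmod_morphism LCmap.
Proof. by move=> a b; apply: LC_ext => q; rewrite lcoefB !lcoef_map raddfB. Qed.
HB.instance Definition _ :=
  GRing.isZmodMorphism.Build (LC K) (LC L) LCmap LCmap_is_zmod_morphism.

End Map.

Section MapRMorphism.
Variables (K L : comPzRingType) (f : {rmorphism K -> L}).

Lemma LCmap_const z : LCmap f (LCconst z) = LCconst (f z).
Proof.
apply: LC_ext => q; rewrite lcoef_map !lcoef_const.
by case: eqP => // _; rewrite raddf0.
Qed.

Fact LCmap_is_monoid_morphism : monoid_morphism (LCmap f).
Proof.
split=> [|a b]; first by rewrite -[1]/(LCconst 1) LCmap_const rmorph1.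
apply: LC_ext => q; rewrite lcoef_map !lcoefM.
have [s us supp_s] := lc_mul_supp q (lcoef_left_finite a) (lcoef_left_finite b).
have map_neq0 x : f x != 0 -> x != 0 by apply: contra_neq => ->; rewrite rmorph0.
rewrite !(lc_mul_seq us) //; last by move=> p /map_neq0 ap /map_neq0; apply: supp_s.
by rewrite raddf_sum; apply: eq_bigr => p _; rewrite -rmorphM.
Qed.
HB.instance Definition _ :=
  GRing.isMonoidMorphism.Build (LC K) (LC L) (LCmap f) LCmap_is_monoid_morphism.

End MapRMorphism.

(** * Valuation, completeness, inverses and square roots *)

Section Valuation.
Variable K : comPzRingType.
Implicit Types a b c e : LC K.

Definition vge (d : rat) : {pred LC K} :=
  [pred a : LC K | `[< forall q, q < d -> a q = 0 >]].

Lemma vgeP {d a} : reflect (forall q, q < d -> a q = 0) (a \in vge d).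
Proof. exact: asboolP. Qed.

Fact vge_zmod_closed d : zmod_closed (vge d).
Proof.
split; first by apply/vgeP.
move=> a b /vgeP a0 /vgeP b0; apply/vgeP => q ltqd.
by rewrite lcoefB a0 ?b0 ?subr0.
Qed.
HB.instance Definition _ d :=
  GRing.isZmodClosed.Build (LC K) (vge d) (vge_zmod_closed d).

Lemma vge_le d d' a : d' <= d -> a \in vge d -> a \in vge d'.
Proof. by move=> ledd' /vgeP a0; apply/vgeP => q ltqd; apply/a0/(lt_le_trans ltqd). Qed.

Lemma vge_lboundP d a : reflect (forall q, a q != 0 -> d <= q) (a \in vge d).
Proof.
apply: (iffP vgeP) => a0 q; first by apply: contra_neqT; rewrite -ltNge; apply: a0.
by apply: contraTeq; rewrite -leNgt; apply: a0.
Qed.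

Lemma vgeM d d' a b : a \in vge d -> b \in vge d' -> a * b \in vge (d + d').
Proof. by move=> /vge_lboundP ad /vge_lboundP bd; apply/vge_lboundP/lc_mul_lbound. Qed.

Lemma vge_single p z : LCsingle p z \in vge p.
Proof. by apply/vgeP => q ltqp; rewrite /= /lc_single lt_eqF. Qed.

Definition valring : {pred LC K} := vge 0.

Fact valring_subring_closed : subring_closed valring.
Proof.
split; first exact: vge_single.
  by move=> a b; apply: rpredB.
by move=> a b av bv; rewrite /valring -[0]addr0; apply: vgeM.
Qed.
HB.instance Definition _ :=
  GRing.isSubringClosed.Build (LC K) valring valring_subring_closed.

Lemma valring_const z : LCconst z \in valring. Proof. exact: vge_single. Qed.

Lemma vge_valring d a : 0 <= d -> a \in vge d -> a \in valring.
Proof. exact: vge_le. Qed.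

Lemma vge_mull d a b : a \in valring -> b \in vge d -> a * b \in vge d.
Proof. by rewrite -{2}[d]add0r; apply: vgeM. Qed.

Lemma vgeX d a m : a \in vge d -> a ^+ m \in vge (m%:R * d).
Proof.
move=> ad; elim: m => [|m IHm]; first by rewrite mul0r; apply: (rpred1 valring).
by rewrite exprS (_ : _ * d = d + m%:R * d) ?mulrSr; [exact: vgeM|ring].
Qed.

Lemma lcoefM_lead d d' a b :
  a \in vge d -> b \in vge d' -> (a * b) (d + d') = a d * b d'.
Proof.
move=> /vge_lboundP ad /vge_lboundP bd.
rewrite lcoefM (@lc_mul_seq _ _ _ _ [:: d]) //.
  by rewrite big_seq1 addrAC subrr add0r.
move=> p /ad ledp /bd ledq; rewrite inE; apply/eqP; lra.
Qed.

Lemma lcoefM0 a b : a \in valring -> b \in valring -> (a * b) 0 = a 0 * b 0.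
Proof. by move=> av bv; rewrite -{1}[0 in LHS]addr0 lcoefM_lead. Qed.

Lemma lcoefX0 a m : a \in valring -> (a ^+ m) 0 = a 0 ^+ m.
Proof.
move=> av; elim: m => [|m IHm]; first by rewrite !expr0.
by rewrite !exprS lcoefM0 ?IHm ?rpredX.
Qed.

Lemma LC_lead a : a != 0 -> exists2 l, a l != 0 & a \in vge l.
Proof.
move=> a_neq0; have [[r ar]|a0] := pselect (exists r, a r != 0).
  have [l al /vge_lboundP] := left_finite_first (lcoef_left_finite a) ar.
  by exists l.
case/eqP: a_neq0; apply: LC_ext => q; apply/eqP; apply: contra_notT a0 => aq.
by exists q.
Qed.

Lemma valring_infinitesimal a :
  a \in valring -> a 0 = 0 -> exists2 d, 0 < d & a \in vge d.
Proof.
move=> /vgeP av a0; have [->|/LC_lead[l al av_l]] := eqVneq a 0.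
  by exists 1; rewrite ?rpred0.
by exists l => //; case: (ltgtP 0 l) al => // [/av->|<-]; rewrite ?a0 eqxx.
Qed.

End Valuation.
Arguments valring {K}.

Lemma LCmap_vge (K L : comPzRingType) (f : {additive K -> L}) d (a : LC K) :
  a \in vge d -> LCmap f a \in vge d.
Proof. by move=> /vgeP a0; apply/vgeP => q ltqd; rewrite lcoef_map a0 ?raddf0. Qed.

Lemma LC_mulf_eq0 (K : idomainType) (a b : LC K) : a * b = 0 -> a = 0 \/ b = 0.
Proof.
move=> ab0; have [->|/LC_lead[l al av]] := eqVneq a 0; first by left.
have [->|/LC_lead[m bm bv]] := eqVneq b 0; first by right.
have := lcoefM_lead av bv; rewrite ab0 lcoef0 => /esym/eqP.
by rewrite mulf_eq0 (negbTE al) (negbTE bm).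
Qed.

Lemma archi_bound_mul (F : archiRealFieldType) (d x : F) :
  0 < d -> x < (Num.bound (`|x| / d))%:R * d.
Proof.
move=> d_gt0; rewrite -ltr_pdivrMr //; apply: le_lt_trans (archi_boundP _).
  by rewrite ler_pM2r ?invr_gt0 // ler_norm.
by rewrite divr_ge0 // ltW.
Qed.

Section Completeness.
Variables (K : comPzRingType) (d : rat).
Hypothesis d_gt0 : 0 < d.
Implicit Types (a b v : LC K) (m : nat).

Lemma vge_eq0 a : (forall m, a \in vge (m%:R * d)) -> a = 0.
Proof.
move=> a_vge; apply: LC_ext => q.
exact: (vgeP (a_vge _) _ (archi_bound_mul q d_gt0)).
Qed.

Lemma LC_complete (u : nat -> LC K) :
  (forall m, u m.+1 - u m \in vge (m%:R * d)) ->
  exists v, forall m, v - u m \in vge (m%:R * d).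
Proof.
move=> u_step.
have u_cauchy m k : u (m + k)%N - u m \in vge (m%:R * d).
  elim: k => [|k IHk]; first by rewrite addn0 subrr rpred0.
  rewrite addnS -(subrKA (u (m + k)%N)) rpredD //.
  by apply: vge_le (u_step _); rewrite ler_pM2r // ler_nat leq_addr.
have u_stable m k q : (m <= k)%N -> q < m%:R * d -> u k q = u m q.
  move=> lemk ltqm; have := vgeP (u_cauchy m (k - m)%N) q ltqm.
  by rewrite subnKC // lcoefB => /eqP; rewrite subr_eq0 => /eqP.
pose N (q : rat) := Num.bound (`|q| / d).
pose v q := u (N q) q.
have vE m q : q < m%:R * d -> v q = u m q.
  move=> ltqm; have [leNm|/ltnW lemN] := leqP (N q) m.
    by rewrite /v (u_stable _ _ _ leNm) ?archi_bound_mul.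
  exact: u_stable.
have fv : left_finite v.
  apply: seq_left_finite => r.
  have [s _ supp_s] := left_finite_seq r (lcoef_left_finite (u (N r))).
  exists s => q ltqr; rewrite (vE (N r)) ?(lt_trans ltqr) ?archi_bound_mul //.
  exact/supp_s/ltW.
by exists (toLC fv) => m; apply/vgeP => q ltqm; rewrite lcoefB /= (vE m) ?subrr.
Qed.

Lemma LC_series (c : nat -> K) (e : LC K) : e \in vge d ->
  exists v, forall m, v - \sum_(i < m) LCconst (c i) * e ^+ i \in vge (m%:R * d).
Proof.
move=> e_vge; apply: LC_complete => m.
rewrite big_ord_recr /= addrAC subrr add0r.
by apply: vge_mull; [exact: valring_const|exact: vgeX].
Qed.

Lemma LC_fixpoint (F : LC K -> LC K) :
  {homo F : a / a \in vge d} ->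
  (forall r a b, a \in vge d -> b \in vge d ->
     a - b \in vge r -> F a - F b \in vge (r + d)) ->
  exists2 v, v \in vge d & F v = v.
Proof.
move=> F_vge F_contr; pose u m := iter m F 0.
have u_vge m : u m \in vge d by elim: m => [|m /F_vge //]; apply: rpred0.
have mulSd m : m.+1%:R * d = m%:R * d + d by rewrite mulrSr; ring.
have [|v v_lim] := @LC_complete u.
  elim=> [|m IHm]; first by rewrite mul0r subr0 (vge_le (ltW d_gt0)) // (u_vge 1%N).
  by rewrite mulSd; exact: F_contr (u_vge _) (u_vge _) IHm.
have v_vge : v \in vge d.
  by rewrite -[v](subrK (u 1%N)) rpredD //; have := v_lim 1%N; rewrite mul1r.
exists v => //; apply/eqP; rewrite -subr_eq0; apply/eqP/vge_eq0 => m.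
have -> : F v - v = (F v - F (u m)) - (v - u m.+1) by rewrite /u iterS; ring.
have le_md : m%:R * d <= m.+1%:R * d by rewrite ler_pM2r // ler_nat.
apply: vge_le le_md _; rewrite rpredB //.
by rewrite mulSd; exact: F_contr v_vge (u_vge _) (v_lim _).
Qed.

End Completeness.

Section InverseAndSquareRoot.
Variable K : comPzRingType.
Implicit Types (a b c e t v : LC K) (s z h : K).

Lemma LC_inv a z :
  a \in valring -> a 0 * z = 1 -> exists2 b, b \in valring & a * b = 1.
Proof.
move=> av az; pose e := 1 - LCconst z * a.
have ev : e \in valring by rewrite rpredB ?rpred1 ?rpredM ?valring_const.
have [|d d_gt0 e_vge] := valring_infinitesimal ev.
  by rewrite lcoefB lcoef_constM mulrC az lcoef1 eqxx subrr.
(* [1 + v] is the inverse of [1 - e] as soon as [v = e * (1 + v)]. *)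
have [||v v_vge v_fix] := @LC_fixpoint K d d_gt0 (fun v => e * (1 + v)).
- move=> v v_vge; rewrite mulrC; apply: vge_mull e_vge.
  by rewrite rpredD ?rpred1 ?(vge_valring (ltW d_gt0)).
- move=> r x y _ _ xy_vge.
  have -> : e * (1 + x) - e * (1 + y) = e * (x - y) by ring.
  by rewrite [r + d]addrC; apply: vgeM.
exists (LCconst z * (1 + v)).
  by rewrite rpredM ?valring_const ?rpredD ?rpred1 ?(vge_valring (ltW d_gt0)).
have -> : a * (LCconst z * (1 + v)) = 1 + v - e * (1 + v) by rewrite /e; ring.
by rewrite v_fix addrK.
Qed.

Lemma LC_sqrt1D e h : 2%:R * h = 1 -> e \in valring -> e 0 = 0 ->
  exists2 t, t \in valring /\ t 0 = 0 & (1 + t) ^+ 2 = 1 + e.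
Proof.
move=> double_h ev e0; have [d d_gt0 e_vge] := valring_infinitesimal ev e0.
have vge_sqr_sub r x y : x \in vge d -> y \in vge d -> x - y \in vge r ->
    x ^+ 2 - y ^+ 2 \in vge (r + d).
  by move=> xv yv xyv; rewrite subr_sqr; apply: vgeM => //; rewrite rpredD.
have half_vge r x : x \in vge r -> LCconst h * x \in vge r.
  by apply: vge_mull; apply: valring_const.
(* [(1 + t) ^+ 2 = 1 + e] means [t = (e - t ^+ 2) / 2]. *)
have [||t t_vge t_fix] :=
    @LC_fixpoint K d d_gt0 (fun t => LCconst h * (e - t ^+ 2)).
- move=> t t_vge; apply/half_vge; rewrite rpredB // expr2 vge_mull //.
  exact: vge_valring (ltW d_gt0) t_vge.
- move=> r x y xv yv xyv; rewrite -mulrBr; apply/half_vge.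
  have -> : e - x ^+ 2 - (e - y ^+ 2) = - (x ^+ 2 - y ^+ 2) by ring.
  by rewrite rpredN; apply: vge_sqr_sub.
exists t; first by split; [exact: vge_valring (ltW d_gt0) t_vge|exact: (vgeP t_vge)].
have double_t : 2%:R * t = e - t ^+ 2.
  rewrite -{1}t_fix mulrA -(rmorph_nat (@LCconst K)) -rmorphM /= double_h.
  by rewrite rmorph1 mul1r.
have -> : (1 + t) ^+ 2 = 1 + 2%:R * t + t ^+ 2 by ring.
by rewrite double_t; ring.
Qed.

Lemma LC_sqrt c s z h : 2%:R * h = 1 -> s * z = 1 -> c \in valring -> c 0 = s ^+ 2 ->
  exists2 b, b \in valring /\ b 0 = s & b ^+ 2 = c.
Proof.
move=> double_h sz cv c0; pose e := LCconst (z ^+ 2) * c - 1.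
have [||t [tv t0] sqr_t] := @LC_sqrt1D e h double_h.
- by rewrite rpredB ?rpred1 ?rpredM ?valring_const.
- by rewrite lcoefB lcoef_constM c0 -exprMn mulrC sz expr1n lcoef1 eqxx subrr.
exists (LCconst s * (1 + t)).
  split; first by rewrite rpredM ?valring_const ?rpredD ?rpred1.
  by rewrite lcoef_constM lcoefD t0 addr0 lcoef1 eqxx mulr1.
rewrite exprMn sqr_t /e [1 + _]addrC subrK mulrA -rmorphXn -rmorphM /=.
by rewrite -exprMn sz expr1n rmorph1 mul1r.
Qed.

End InverseAndSquareRoot.

(** * Absolute values and maximum norms *)

Section RealLeviCivita.
Variable R : realType.
Implicit Types a b c t : LC R.

Lemma lc_le_anti (a b : rat -> R) : lc_le a b -> lc_le b a -> a = b.
Proof.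
move=> [//|[q [ab_q ab_lt]]] [//|[p [ba_p ba_lt]]]; exfalso.
move: ab_q ba_p; rewrite /lc_sub; case: (ltgtP p q) => [ltpq|ltqp|->].
- by have := ab_lt _ ltpq; rewrite /lc_sub; lra.
- by have := ba_lt _ ltqp; rewrite /lc_sub; lra.
- by lra.
Qed.

Lemma lc_le_lcoef0 a b : a \in valring -> b \in valring -> a 0 < b 0 -> lc_le a b.
Proof.
move=> /vgeP av /vgeP bv lt_ab; right; exists 0; rewrite /lc_sub subr_gt0.
by split=> // p ltp0; rewrite av ?bv ?subr0.
Qed.

Lemma lc_ge0P c :
  lc_le (lc_zero R) c <-> c = 0 \/ exists2 l, 0 < c l & c \in vge l.
Proof.
split=> [[c0|[l [c_l c_lt]]]|[->|[l c_l /vgeP c_lt]]].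
- by left; apply: LC_ext => q; rewrite -c0.
- right; exists l; first by rewrite /lc_sub subr0 in c_l.
  by apply/vgeP => q /c_lt; rewrite /lc_sub subr0.
- by left.
- by right; exists l; rewrite /lc_sub subr0; split=> // q /c_lt ->; rewrite subr0.
Qed.

Lemma lc_ge0_sqrt_exists c : lc_le (lc_zero R) c ->
  exists2 t : LC R, lc_le (lc_zero R) t & t ^+ 2 = c.
Proof.
move=> /lc_ge0P[->|[l c_l c_vge]]; first by exists 0; [left|rewrite expr2 mulr0].
pose s := Num.sqrt (c l); have s_gt0 : 0 < s by rewrite sqrtr_gt0.
have cv : LCsingle (- l) 1 * c \in valring.
  by rewrite /valring -(addNr l) vgeM ?vge_single.
have [|||t [tv t0] sqr_t] := @LC_sqrt R _ s s^-1 2^-1 _ _ cv.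
- by rewrite divff ?pnatr_eq0.
- by rewrite divff ?gt_eqF.
- by rewrite lcoef_singleM mul1r sub0r opprK sqr_sqrtr // ltW.
exists (LCsingle (l / 2) 1 * t).
  apply/lc_ge0P; right; exists (l / 2); first by rewrite lcoef_singleM subrr t0 mul1r.
  by rewrite -[X in vge X]addr0 vgeM ?vge_single.
rewrite exprMn sqr_t; apply: LC_ext => q.
by rewrite expr2 -mulrA !lcoef_singleM !mul1r; congr (c _); lra.
Qed.

Lemma lc_sqrtP c : lc_le (lc_zero R) c ->
  exists t : LC R, [/\ lcoef t = lc_sqrt c, lc_le (lc_zero R) t & t ^+ 2 = c].
Proof.
move=> /lc_ge0_sqrt_exists[s s_ge0 sqr_s].
pose is_sqrt (t : rat -> R) := left_finite t /\ lc_le (lc_zero R) t /\ lc_mul t t = c.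
have [ft [t_ge0 sqr_t]] : is_sqrt (lc_sqrt c).
  apply: (ClassicalEpsilon.epsilon_spec _ is_sqrt); exists s.
  by rewrite /is_sqrt -sqr_s expr2 -lcoefM; split; first exact: lcoef_left_finite.
by exists (toLC ft); split=> //; apply: val_inj; rewrite expr2.
Qed.

End RealLeviCivita.

Section ComplexLeviCivita.
Variable R : realType.
Implicit Types (t : LC R) (z s : LC R[i]).

Definition LCre : LC R[i] -> LC R := LCmap (@complex.Re R).
Definition LCim : LC R[i] -> LC R := LCmap (@complex.Im R).
Definition LCreal : LC R -> LC R[i] := LCmap (real_complex R).
Definition LCconj : LC R[i] -> LC R[i] := LCmap (@Num.conj R[i]).
HB.instance Definition _ := GRing.RMorphism.on LCreal.
HB.instance Definition _ := GRing.RMorphism.on LCconj.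

Lemma lcoef_real t : lcoef (LCreal t) = lc_RC t.
Proof. by []. Qed.

Lemma lcoef_real0 t : (LCreal t) 0 = (t 0)%:C%C.
Proof. by []. Qed.

Lemma LCconj_real t : LCconj (LCreal t) = LCreal t.
Proof. by apply: LC_ext => q; apply/CrealP; rewrite complex_real. Qed.

Lemma LC_complexE z : z = LCreal (LCre z) + LCconst 'i * LCreal (LCim z).
Proof.
apply: LC_ext => q; rewrite lcoefD lcoef_constM !lcoef_map /= -complexiE.
exact: complexE.
Qed.

Lemma mul_LCconj z : z * LCconj z = LCreal (LCre z ^+ 2 + LCim z ^+ 2).
Proof.
have -> : LCconj z = LCreal (LCre z) - LCconst 'i * LCreal (LCim z).
  rewrite [in LHS](LC_complexE z) rmorphD rmorphM /= !LCconj_real.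
  by rewrite /LCconj LCmap_const /= conjCi rmorphN mulNr.
rewrite {1}(LC_complexE z) rmorphD !rmorphXn /= [LHS]mulrC -subr_sqr exprMn.
rewrite -(rmorphXn (@LCconst R[i])) /=.
by rewrite sqrCi rmorphN rmorph1; ring.
Qed.

Lemma LCnormsq_ge0 z : lc_le (lc_zero R) (LCre z ^+ 2 + LCim z ^+ 2).
Proof.
have [->|/LC_lead[l zl z_vge]] := eqVneq z 0.
  by left; rewrite /LCre /LCim !raddf0 expr2 mulr0 addr0.
have re_vge : LCre z \in vge l by exact: LCmap_vge.
have im_vge : LCim z \in vge l by exact: LCmap_vge.
apply/lc_ge0P; right; exists (l + l); last by rewrite !expr2 rpredD ?vgeM.
rewrite !expr2 lcoefD !lcoefM_lead // -!expr2 !lcoef_map /=.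
by rewrite -ltcR /= add_Re2_Im2 exprn_gt0 ?normr_gt0.
Qed.

Lemma lc_absCP z : exists t : LC R,
  [/\ lcoef t = lc_absC z, lc_le (lc_zero R) t & LCreal t ^+ 2 = z * LCconj z].
Proof.
have [t [abs_t t_ge0 sqr_t]] := lc_sqrtP (LCnormsq_ge0 z); exists t.
by rewrite mul_LCconj -sqr_t rmorphXn.
Qed.

Lemma left_finite_absC z : left_finite (lc_absC z).
Proof. by have [t [<- _ _]] := lc_absCP z; apply: lcoef_left_finite. Qed.

Definition LCabs z : LC R := toLC (left_finite_absC z).

Lemma lcoef_abs z : lcoef (LCabs z) = lc_absC z.
Proof. by []. Qed.

Lemma LCabs_ge0 z : lc_le (lc_zero R) (LCabs z).
Proof. by have [t [abs_t t_ge0 _]] := lc_absCP z; rewrite lcoef_abs -abs_t. Qed.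

Lemma sqr_LCabs z : LCreal (LCabs z) ^+ 2 = z * LCconj z.
Proof.
by have [t [abs_t _ <-]] := lc_absCP z; congr (LCreal _ ^+ 2); apply: val_inj.
Qed.

Lemma lcoefM_conj0 z : z \in valring -> (z * LCconj z) 0 = `|z 0| ^+ 2.
Proof. by move=> zv; rewrite lcoefM0 ?LCmap_vge // normCK. Qed.

Lemma LCabs_valring z : z \in valring -> LCabs z \in valring.
Proof.
move=> zv; case/lc_ge0P: (LCabs_ge0 z) => [->|[l abs_l abs_vge]]; first exact: rpred0.
have [l_ge0|l_lt0] := leP 0 l; first exact: vge_le abs_vge.
have ll_lt0 : l + l < 0 by lra.
have sqr_v : LCreal (LCabs z) ^+ 2 \in valring.
  by rewrite sqr_LCabs rpredM ?LCmap_vge.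
have /eqP := vgeP sqr_v _ ll_lt0; rewrite expr2 lcoefM_lead ?LCmap_vge //.
by rewrite mulf_eq0 orbb lcoef_map /= fmorph_eq0 gt_eqF.
Qed.

Lemma lcoef_abs0 z : z \in valring -> (LCabs z 0)%:C%C = `|z 0|.
Proof.
move=> zv; have absv := LCabs_valring zv.
have abs0_ge0 : 0 <= LCabs z 0.
  case/lc_ge0P: (LCabs_ge0 z) => [->|[l abs_l /vgeP abs_vge]]; first by rewrite lcoef0.
  case: (ltgtP 0 l) => [l_gt0|l_lt0|->]; last exact: ltW.
    by rewrite abs_vge.
  by rewrite (vgeP absv _ l_lt0) ltxx in abs_l.
apply/eqP; rewrite -(eqrXn2 (n := 2)) ?normr_ge0 ?ler0c //.
by rewrite -lcoef_real0 -lcoefX0 ?LCmap_vge // sqr_LCabs lcoefM_conj0.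
Qed.

Lemma LCabs_unique z s : z \in valring -> z 0 != 0 ->
  s \in valring -> s 0 = `|z 0| -> s ^+ 2 = z * LCconj z -> s = LCreal (LCabs z).
Proof.
move=> zv z0 sv s0; rewrite -sqr_LCabs => /eqP; rewrite -subr_eq0 subr_sqr => /eqP.
case/LC_mulf_eq0 => [/eqP|]; first by rewrite subr_eq0 => /eqP.
move=> /(congr1 (fun a : LC R[i] => a 0)) /eqP.
rewrite lcoefD lcoef_real0 s0 lcoef_abs0 // lcoef0 -mulr2n mulrn_eq0 /=.
by rewrite normr_eq0 (negbTE z0).
Qed.

Lemma lc_inv_eq (a b : LC R[i]) : a * b = 1 -> lc_inv a = b.
Proof.
move=> ab.
pose is_inv (c : rat -> R[i]) := left_finite c /\ lc_mul a c = lc_one R[i].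
have [fc ac] : is_inv (lc_inv a).
  apply: (ClassicalEpsilon.epsilon_spec _ is_inv); exists b.
  by split; [exact: lcoef_left_finite|rewrite -lcoefM ab].
have {}ac : a * toLC fc = 1 by apply/val_inj.
by rewrite -[b]mulr1 -ac mulrA [b * a]mulrC ab mul1r.
Qed.

End ComplexLeviCivita.

Section MaxNormalization.
Variable R : realType.
Implicit Types (r : LC R) (z t : LC R[i]).

Lemma LCabs_inv z : z \in valring -> z 0 != 0 ->
  exists t, LCreal (LCabs z) * t = 1.
Proof.
move=> zv z0.
have absv : LCreal (LCabs z) \in valring by rewrite LCmap_vge ?LCabs_valring.
have [|t _ abs_t] := @LC_inv _ _ `|z 0|^-1 absv; last by exists t.
by rewrite lcoef_real0 lcoef_abs0 // divff ?normr_eq0.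
Qed.

Lemma lcoef_realM0 r z : r \in valring -> z \in valring ->
  (LCreal r * z) 0 = (r 0)%:C%C * z 0.
Proof. by move=> rv zv; rewrite lcoefM0 ?LCmap_vge. Qed.

Lemma LCabsZ r z : r \in valring -> 0 < r 0 -> z \in valring -> z 0 != 0 ->
  LCreal (LCabs (LCreal r * z)) = LCreal r * LCreal (LCabs z).
Proof.
move=> rv r0 zv z0.
have r0C : 0 < (r 0)%:C%C :> R[i] by rewrite (ltcR 0).
apply/esym/LCabs_unique; rewrite ?rpredM ?LCmap_vge ?LCabs_valring //.
- by rewrite lcoef_realM0 // mulf_neq0 // gt_eqF.
- rewrite !lcoef_realM0 ?LCmap_vge ?LCabs_valring // lcoef_real0 lcoef_abs0 //.
  by rewrite normrM gtr0_norm.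
- by rewrite exprMn sqr_LCabs rmorphM /= LCconj_real expr2 mulrACA.
Qed.

Variable m : nat.
Implicit Types (x : lc_vec R m) (y : 'I_m -> LC R[i]) (i : 'I_m).

Definition dominant y i0 :=
  [/\ forall i, y i \in valring, y i0 0 != 0 &
      forall i, i != i0 -> `|y i 0| < `|y i0 0|].

Definition lc_normalize x : lc_vec R m :=
  lc_vscale (lc_inv (lc_RC (lc_maxnorm x))) x.

Lemma lc_maxnorm_eq x i0 : (forall i, lc_le (lc_absC (x i)) (lc_absC (x i0))) ->
  lc_maxnorm x = lc_absC (x i0).
Proof.
move=> le_x; pose is_max M :=
  (exists i, M = lc_absC (x i)) /\ forall i, lc_le (lc_absC (x i)) M.
have [[i ->] max_i] : is_max (lc_maxnorm x).
  apply: (ClassicalEpsilon.epsilon_spec _ is_max).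
  by exists (lc_absC (x i0)); split; first by exists i0.
exact: lc_le_anti.
Qed.

Lemma lc_maxnorm_dominant y i0 : dominant y i0 ->
  lc_maxnorm (fun i => lcoef (y i)) = LCabs (y i0).
Proof.
move=> [yv _ lt_y]; apply: (lc_maxnorm_eq (i0 := i0)) => i.
have [->|/lt_y lt_i] := eqVneq i i0; first by left.
apply: (@lc_le_lcoef0 _ (LCabs _) (LCabs _)); rewrite ?LCabs_valring //.
by rewrite -ltcR !lcoef_abs0.
Qed.

Lemma lc_normalize_dominant y i0 t : dominant y i0 ->
  LCreal (LCabs (y i0)) * t = 1 ->
  lc_normalize (fun i => lcoef (y i)) = fun i => lcoef (t * y i).
Proof.
move=> y_dom abs_t; apply/funext => i.
by rewrite /lc_normalize (lc_maxnorm_dominant y_dom) -lcoef_real (lc_inv_eq abs_t).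
Qed.

Lemma dominantZ r y i0 : r \in valring -> 0 < r 0 -> dominant y i0 ->
  dominant (fun i => LCreal r * y i) i0.
Proof.
move=> rv r0 [yv y0 lt_y]; have r0C : 0 < (r 0)%:C%C :> R[i] by rewrite (ltcR 0).
split=> [i||i /lt_y]; first by rewrite rpredM ?LCmap_vge.
  by rewrite lcoef_realM0 // mulf_neq0 // gt_eqF.
by rewrite !lcoef_realM0 // !normrM ltr_pM2l ?normr_gt0 ?gt_eqF.
Qed.

Lemma lc_normalizeZ r y i0 : r \in valring -> 0 < r 0 -> dominant y i0 ->
  lc_normalize (fun i => lcoef (LCreal r * y i)) = lc_normalize (fun i => lcoef (y i)).
Proof.
move=> rv r0 y_dom; have [yv y0 _] := y_dom.
have [t abs_t] := LCabs_inv (yv i0) y0.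
have [|r' _ rr'] := @LC_inv _ r (r 0)^-1 rv; first by rewrite divff ?gt_eqF.
have {}rr' : LCreal r * LCreal r' = 1 by rewrite -rmorphM rr' rmorph1.
rewrite (lc_normalize_dominant y_dom abs_t).
rewrite (lc_normalize_dominant (t := LCreal r' * t) (dominantZ rv r0 y_dom)).
  by apply/funext => i; rewrite mulrACA [LCreal r' * _]mulrC rr' mul1r.
by rewrite LCabsZ // mulrACA rr' abs_t mul1r.
Qed.

End MaxNormalization.

(** * Tame sequences *)

Section ConvergentSequences.
Variable C : numFieldType.

Definition cseq_pred : {pred option nat -> C} :=
  [pred f : option nat -> C | `[< f (Some k) @[k --> \oo] --> f None >]].

Fact cseq_subring_closed : subring_closed cseq_pred.
Proof.
split; first by apply/asboolP; exact: cvg_cst.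
- by move=> f g /asboolP f_lim /asboolP g_lim; apply/asboolP; exact: cvgB f_lim g_lim.
- by move=> f g /asboolP f_lim /asboolP g_lim; apply/asboolP; exact: cvgM f_lim g_lim.
Qed.
HB.instance Definition _ :=
  GRing.isSubringClosed.Build (option nat -> C) cseq_pred cseq_subring_closed.

(* [f (Some k)] is the [k]-th term of the sequence and [f None] its limit. *)
Record cseq := MkCseq { cseq_fun :> option nat -> C; _ : cseq_fun \in cseq_pred }.
HB.instance Definition _ := [isSub for cseq_fun].
HB.instance Definition _ := [Choice of cseq by <:].
HB.instance Definition _ := [SubChoice_isSubComNzRing of cseq by <:].

Lemma cseqP (f : cseq) : f (Some k) @[k --> \oo] --> f None.
Proof. by case: f => f /= /asboolP. Qed.

Lemma cseq_ext (f g : cseq) : (forall o, f o = g o) -> f = g.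
Proof. by move=> eq_fg; apply/val_inj/funext. Qed.

Lemma cseqB (f g : cseq) o : (f - g) o = f o - g o. Proof. by []. Qed.
Lemma cseqM (f g : cseq) o : (f * g) o = f o * g o. Proof. by []. Qed.

Definition to_cseq (u : nat -> C) (l : C) (u_lim : u @ \oo --> l) : cseq :=
  @MkCseq (fun o => if o is Some k then u k else l) (asboolT u_lim).

Definition cseq_eval (o : option nat) (f : cseq) : C := f o.
Fact cseq_eval_is_zmod_morphism o : zmod_morphism (cseq_eval o).
Proof. by []. Qed.
Fact cseq_eval_is_monoid_morphism o : monoid_morphism (cseq_eval o).
Proof. by []. Qed.
HB.instance Definition _ o :=
  GRing.isZmodMorphism.Build cseq C (cseq_eval o) (cseq_eval_is_zmod_morphism o).
HB.instance Definition _ o :=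
  GRing.isMonoidMorphism.Build cseq C (cseq_eval o) (cseq_eval_is_monoid_morphism o).

Definition cseq_cst (z : C) : cseq := to_cseq (cvg_cst z).
Fact cseq_cst_is_zmod_morphism : zmod_morphism cseq_cst.
Proof. by move=> y z; apply: cseq_ext => -[]. Qed.
Fact cseq_cst_is_monoid_morphism : monoid_morphism cseq_cst.
Proof. by split=> [|y z]; apply: cseq_ext => -[]. Qed.
HB.instance Definition _ :=
  GRing.isZmodMorphism.Build C cseq cseq_cst cseq_cst_is_zmod_morphism.
HB.instance Definition _ :=
  GRing.isMonoidMorphism.Build C cseq cseq_cst cseq_cst_is_monoid_morphism.

(* Replacing the first [N] terms by the limit makes a sequence with nonzero limit
invertible without moving the other terms. *)
Definition cseq_freeze_index (N : nat) (o : option nat) : option nat :=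
  if o is Some k then if (N <= k)%N then Some k else None else None.

Fact cseq_freeze_cvg N (f : cseq) :
  f (cseq_freeze_index N (Some k)) @[k --> \oo] --> f None.
Proof.
apply: cvg_trans (@cseqP f); apply: near_eq_cvg.
by exists N => // k leNk; rewrite /= ifT.
Qed.

Definition cseq_freeze N (f : cseq) : cseq := to_cseq (cseq_freeze_cvg N (f := f)).

Lemma cseq_freezeE N f o : cseq_freeze N f o = f (cseq_freeze_index N o).
Proof. by case: o. Qed.

Fact cseq_freeze_is_zmod_morphism N : zmod_morphism (cseq_freeze N).
Proof. by move=> f g; apply: cseq_ext => o; rewrite cseqB !cseq_freezeE cseqB. Qed.
HB.instance Definition _ N :=
  GRing.isZmodMorphism.Build cseq cseq (cseq_freeze N) (cseq_freeze_is_zmod_morphism N).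

Lemma cseq_inv (f : cseq) : (forall o, f o != 0) -> exists g, f * g = 1.
Proof.
move=> f_neq0; exists (to_cseq (cvgV (f_neq0 None) (@cseqP f))).
by apply: cseq_ext => -[k|]; apply: divff.
Qed.

Lemma cseq_freeze_neq0 (f : cseq) : f None != 0 ->
  exists N, forall o, cseq_freeze N f o != 0.
Proof.
move=> f_lim; have : \forall k \near \oo, f (Some k) != 0.
  by apply: (cvgr_neq0 (f None)) => //; exact: cseqP.
case=> N _ f_neq0; exists N => o; rewrite cseq_freezeE.
by case: o => //= k; case: ifP => // /f_neq0.
Qed.

Definition cseq_norm (f : cseq) : cseq := to_cseq (cvg_norm (@cseqP f)).
Lemma cseq_normE f o : cseq_norm f o = `|f o|. Proof. by case: o. Qed.

End ConvergentSequences.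

Lemma cvg_conj (C : numClosedFieldType) (T : Type) (F : set_system T)
    {FF : Filter F} (f : T -> C) (l : C) :
  f @ F --> l -> (f t)^* @[t --> F] --> l^*.
Proof.
move=> /cvgrPdist_lt f_lim; apply/cvgrPdist_lt => e /f_lim.
by apply: filterS => t; rewrite -rmorphB norm_conjC.
Qed.

Section ConvergentConjugate.
Variable C : numClosedFieldType.

Definition cseq_conj (f : cseq C) : cseq C := to_cseq (cvg_conj (@cseqP _ f)).

Lemma cseq_conjE f o : cseq_conj f o = (f o)^*. Proof. by case: o. Qed.

Fact cseq_conj_is_zmod_morphism : zmod_morphism cseq_conj.
Proof.
by move=> f g; apply: cseq_ext => o; rewrite cseqB !cseq_conjE cseqB rmorphB.
Qed.
HB.instance Definition _ :=
  GRing.isZmodMorphism.Build (cseq C) (cseq C) cseq_conj cseq_conj_is_zmod_morphism.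

End ConvergentConjugate.

Lemma near_lt_normr (C : numFieldType) (T : Type) (F : set_system T)
    {FF : Filter F} (f g : T -> C) (a b : C) :
  f @ F --> a -> g @ F --> b -> `|a| < `|b| ->
  \forall t \near F, `|f t| < `|g t|.
Proof.
move=> /cvgrPdist_lt f_lim /cvgrPdist_lt g_lim lt_ab; pose e := (`|b| - `|a|) / 2.
have e_gt0 : 0 < e by rewrite divr_gt0 ?subr_gt0.
apply: filterS2 (f_lim e e_gt0) (g_lim e e_gt0) => t f_close g_close.
apply: (@lt_trans _ _ (`|a| + e)).
  rewrite -[f t](subKr a); apply: le_lt_trans (ler_normB _ _) _.
  by rewrite ltrD2l.
have -> : `|a| + e = `|b| - e by rewrite /e; field.
rewrite ltrBlDr -[b](subrKC (g t)); apply: le_lt_trans (ler_normD _ _) _.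
by rewrite ltrD2l.
Qed.

Section TameConvergence.
Variable C : numFieldType.
Implicit Types (u v : nat -> LC C) (a l m : LC C) (G : LC (cseq C)).

Definition LCeval o : LC (cseq C) -> LC C := LCmap (@cseq_eval C o).
Definition LCcst : LC C -> LC (cseq C) := LCmap (@cseq_cst C).
Definition LCfreeze N : LC (cseq C) -> LC (cseq C) := LCmap (@cseq_freeze C N).
HB.instance Definition _ o := GRing.RMorphism.on (LCeval o).

Lemma LCeval_cst o a : LCeval o (LCcst a) = a.
Proof. by apply: LC_ext => q; case: o. Qed.

Lemma LCeval_freeze N o G : LCeval o (LCfreeze N G) = LCeval (cseq_freeze_index N o) G.
Proof. by apply: LC_ext => q; apply: cseq_freezeE. Qed.

Definition tame_cvg u l := exists G,
  [/\ G \in valring, LCeval None G = l & \forall k \near \oo, LCeval (Some k) G = u k].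

Lemma tame_cvg_cst a : a \in valring -> tame_cvg (fun=> a) a.
Proof.
move=> av; exists (LCcst a); rewrite LCmap_vge ?LCeval_cst //; split=> //.
by apply: nearW => k; rewrite LCeval_cst.
Qed.

Lemma tame_cvgD u v l m :
  tame_cvg u l -> tame_cvg v m -> tame_cvg (fun k => u k + v k) (l + m).
Proof.
move=> [G [Gv <- Gu]] [H [Hv <- Hu]]; exists (G + H); rewrite rpredD ?rmorphD //.
by split=> //; apply: filterS2 Gu Hu => k <- <-; rewrite rmorphD.
Qed.

Lemma tame_cvgM u v l m :
  tame_cvg u l -> tame_cvg v m -> tame_cvg (fun k => u k * v k) (l * m).
Proof.
move=> [G [Gv <- Gu]] [H [Hv <- Hu]]; exists (G * H); rewrite rpredM ?rmorphM //.
by split=> //; apply: filterS2 Gu Hu => k <- <-; rewrite rmorphM.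
Qed.

Lemma tame_cvg_sum (I : Type) (s : seq I) (P : pred I)
    (u : I -> nat -> LC C) (l : I -> LC C) :
  (forall i, P i -> tame_cvg (u i) (l i)) ->
  tame_cvg (fun k => \sum_(i <- s | P i) u i k) (\sum_(i <- s | P i) l i).
Proof.
move=> u_lim; elim: s => [|i s IHs].
  by rewrite big_nil; under eq_fun do rewrite big_nil; apply/tame_cvg_cst/rpred0.
rewrite big_cons; under eq_fun do rewrite big_cons.
by case: ifP => // /u_lim; move/tame_cvgD; apply.
Qed.

Lemma tame_cvg_valring u l : tame_cvg u l -> \forall k \near \oo, u k \in valring.
Proof. by move=> [G [Gv _]]; apply: filterS => k <-; apply: LCmap_vge. Qed.

Lemma tame_cvg_lcoef u l q : tame_cvg u l -> u k q @[k --> \oo] --> l q.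
Proof.
move=> [G [_ <- Gu]]; apply: cvg_trans (@cseqP _ (G q)); apply: near_eq_cvg.
by apply: filterS Gu => k <-.
Qed.

Lemma tame_cvg_lt_lcoef0 u v l m : tame_cvg u l -> tame_cvg v m ->
  `|l 0| < `|m 0| -> \forall k \near \oo, `|u k 0| < `|v k 0|.
Proof. by move=> u_lim v_lim; apply: near_lt_normr; exact: tame_cvg_lcoef. Qed.

Lemma tame_cvg_witness u l : tame_cvg u l -> l 0 != 0 -> exists G,
  [/\ G \in valring, LCeval None G = l, \forall k \near \oo, LCeval (Some k) G = u k &
      forall o, (G 0) o != 0].
Proof.
move=> [G [Gv <- Gu]] G0; have [N frozen_neq0] := cseq_freeze_neq0 (f := G 0) G0.
exists (LCfreeze N G); split=> //; first exact: LCmap_vge.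
  by rewrite LCeval_freeze.
apply: filterS2 Gu (nbhs_infty_ge N) => k <- leNk.
by rewrite LCeval_freeze /= ifT.
Qed.

Lemma tame_cvgV u l : tame_cvg u l -> l 0 != 0 -> exists v m,
  [/\ tame_cvg v m, l * m = 1 & \forall k \near \oo, u k * v k = 1].
Proof.
move=> u_lim l0; have [G [Gv <- Gu G0]] := tame_cvg_witness u_lim l0.
have [z Gz] := cseq_inv G0; have [H Hv GH] := LC_inv Gv Gz.
have eval_GH o : LCeval o G * LCeval o H = 1 by rewrite -rmorphM GH rmorph1.
exists (fun k => LCeval (Some k) H), (LCeval None H); split=> //.
  by exists H; split=> //; apply: nearW.
by apply: filterS Gu => k <-.
Qed.

End TameConvergence.

Lemma normr_real_complex (R : rcfType) (x : R) : `|x%:C%C| = `|x|%:C%C :> R[i].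
Proof. by rewrite normc_def /= expr0n addr0 sqrtr_sqr. Qed.

Lemma exprDn_widen (K : comPzRingType) (x y : K) k n : (k < n)%N ->
  (x + y) ^+ k = \sum_(i < n) 'C(k, i)%:R * x ^+ (k - i) * y ^+ i.
Proof.
move=> /subnKC<-; rewrite big_split_ord /= [X in _ = _ + X]big1 ?addr0; last first.
  by move=> i _; rewrite bin_small ?mul0r // addSn ltnS leq_addr.
by rewrite exprDn; apply: eq_bigr => i _; rewrite -mulrA mulr_natl.
Qed.

Section PowersOfContractions.
Variable R : realType.
Local Notation C := (R[i] : numFieldType).

Lemma cvg_bin_expr (x : R) i : `|x| < 1 ->
  'C(k, i)%:R * x ^+ (k - i) @[k --> \oo] --> (0 : R).
Proof.
move=> x_lt1; have x_ge0 := normr_ge0 x.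
pose h := (1 - `|x|) / 2; have h_gt0 : 0 < h by rewrite /h; lra.
have xh_lt1 : `| `|x| + h| < 1 by rewrite ger0_norm /h; lra.
have geo_lim : h ^- i * (`|x| + h) ^+ k @[k --> \oo] --> (0 : R).
  by rewrite -[X in _ --> X](mulr0 (h ^- i)); exact: cvgM (cvg_cst _) (cvg_expr xh_lt1).
apply: norm_cvg0; apply: (squeeze_cvgr _ (cvg_cst 0) geo_lim).
apply: nearW => k; rewrite normr_ge0 /= [h ^- i * _]mulrC ler_pdivlMr ?exprn_gt0 //.
rewrite normrM normr_nat normrX.
have [ltki|leik] := ltnP k i.
  by rewrite bin_small // !mul0r exprn_ge0 //; lra.
(* The left-hand side is the [i]-th term of the expansion of [(h + `|x|) ^+ k]. *)
rewrite exprDn (bigD1 (Ordinal (leik : (i < k.+1)%N))) //= mulr_natl.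
rewrite -mulrnAl lerDl sumr_ge0 // => j _.
by rewrite mulrn_wge0 // mulr_ge0 // exprn_ge0 // ltW.
Qed.

Lemma cvg_real_complex (T : Type) (F : set_system T) {FF : Filter F}
    (f : T -> R) (l : R) :
  f @ F --> l -> ((f t)%:C%C : C) @[t --> F] --> (l%:C%C : C).
Proof.
move=> /cvgrPdist_lt f_lim; apply/cvgrPdist_lt => e.
rewrite ltcE /= => /andP[/eqP e_real /f_lim]; apply: filterS => t.
by rewrite -rmorphB normr_real_complex ltcE /= e_real eqxx.
Qed.

Lemma cvg_bin_expr_complex (z : R[i]) i : `|z| < 1 ->
  ('C(k, i)%:R * z ^+ (k - i) : C) @[k --> \oo] --> (0 : C).
Proof.
rewrite normc_def -[1]/(1%:C%C) ltcR; set x := Num.sqrt _ => x_lt1.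
apply: norm_cvg0.
have x_norm : `|x| < 1 by rewrite ger0_norm ?sqrtr_ge0.
apply: cvg_trans (cvg_real_complex (cvg_bin_expr i x_norm)).
apply: near_eq_cvg; apply: nearW => k.
by rewrite normrM normr_nat normrX normc_def rmorphM rmorphXn rmorph_nat.
Qed.

Lemma tame_cvg_expr (mu : LC R[i]) : mu \in valring -> `|mu 0| < 1 ->
  tame_cvg (fun k => mu ^+ k) 0.
Proof.
move=> muv mu_lt1; pose e := mu - LCconst (mu 0).
have ev : e \in valring by rewrite rpredB ?valring_const.
have [|d d_gt0 e_vge] := valring_infinitesimal ev; first by rewrite lcoefB subrr.
pose b i : cseq R[i] := to_cseq (cvg_bin_expr_complex i mu_lt1).
have [G G_lim] := LC_series d_gt0 b (LCmap_vge (@cseq_cst R[i]) e_vge).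
have G_eval o m :
    LCeval o G - \sum_(i < m) LCconst (b i o) * e ^+ i \in vge (m%:R * d).
  have -> : \sum_(i < m) LCconst (b i o) * e ^+ i =
      LCeval o (\sum_(i < m) LCconst (b i) * LCcst e ^+ i).
    rewrite rmorph_sum; apply: eq_bigr => i _.
    by rewrite rmorphM rmorphXn /= LCeval_cst /LCeval LCmap_const.
  by rewrite -rmorphB; apply: LCmap_vge (G_lim m).
exists G; split.
- by have := G_lim 0%N; rewrite big_ord0 subr0 mul0r.
- apply: (vge_eq0 d_gt0) => m; have := G_eval None m.
  by rewrite big1 ?subr0 // => i _; rewrite /= rmorph0 mul0r.
- apply: nearW => k; apply/eqP; rewrite -subr_eq0; apply/eqP/(vge_eq0 d_gt0) => m.
  have -> : mu ^+ k = \sum_(i < m + k.+1) LCconst (b i (Some k)) * e ^+ i.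
    rewrite -{1}[mu](subrKC (LCconst (mu 0))) (exprDn_widen _ _ (leq_addl m k.+1)).
    by apply: eq_bigr => i _; rewrite rmorphM rmorphXn rmorph_nat.
  by apply: vge_le (G_eval _ _); rewrite ler_pM2r // ler_nat leq_addr.
Qed.

Lemma tame_cvg_abs (u : nat -> LC R[i]) (l : LC R[i]) : tame_cvg u l -> l 0 != 0 ->
  tame_cvg (fun k => LCreal (LCabs (u k))) (LCreal (LCabs l)).
Proof.
move=> u_lim l0; have [G [Gv Gl Gu G0]] := tame_cvg_witness u_lim l0.
pose Gbar := LCmap (@cseq_conj R[i]) G.
have [|z norm_inv] := @cseq_inv _ (cseq_norm (G 0)).
  by move=> o; rewrite cseq_normE normr_eq0.
have GGv : G * Gbar \in valring by rewrite rpredM ?LCmap_vge.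
have [||S [Sv S0] sqr_S] := @LC_sqrt _ _ _ _ (cseq_cst 2^-1) _ norm_inv GGv.
- rewrite -(rmorph_nat (@cseq_cst R[i])) -rmorphM /= divff ?pnatr_eq0 //.
  exact: rmorph1.
- rewrite lcoefM0 ?LCmap_vge //; apply: cseq_ext => o.
  by rewrite expr2 !cseqM cseq_normE lcoef_map cseq_conjE -expr2 normCK.
have eval_S o : LCeval o S = LCreal (LCabs (LCeval o G)).
  apply: LCabs_unique; rewrite ?LCmap_vge //; first exact: G0.
    by rewrite !lcoef_map S0; apply: cseq_normE.
  rewrite -rmorphXn sqr_S rmorphM; congr (_ * _).
  by apply: LC_ext => q; apply: cseq_conjE.
exists S; split=> //; first by rewrite eval_S Gl.
by apply: filterS Gu => k <-.
Qed.

End PowersOfContractions.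

Section WeakConvergence.
Variable R : realType.

Lemma lc_seminorm_le (a : rat -> R[i]) (s e : R) :
  (forall q, ratr q <= s -> complex.Re `|a q| <= e) -> lc_seminorm a s <= e.
Proof.
move=> a_le; apply: ge_sup => [|_ [q leqs <-]]; last exact: a_le.
exists (complex.Re `|a (Num.floor s)%:~R|), (Num.floor s)%:~R => //=.
by rewrite ratr_int floor_le.
Qed.

Lemma lc_wk_cvg_near (u v : nat -> rat -> R[i]) a :
  (\forall k \near \oo, u k = v k) -> lc_wk_cvg u a -> lc_wk_cvg v a.
Proof.
move=> [M _ eq_uv] u_cvg r r_gt0; have [N u_lt] := u_cvg r r_gt0.
exists (maxn M N) => k; rewrite gtn_max => /andP[/ltnW leMk ltNk].
by rewrite -(eq_uv k leMk) u_lt.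
Qed.

Lemma tame_cvg_wk (u : nat -> LC R[i]) (l : LC R[i]) :
  tame_cvg u l -> lc_wk_cvg (fun k => lcoef (u k)) l.
Proof.
move=> [G [_ <- Gu]] r r_gt0; have r2_gt0 : 0 < ((r / 2)%:C)%C :> R[i].
  by rewrite (ltcR 0) divr_gt0.
pose b : rat := (Num.ceil r^-1)%:~R.
have le_b q : ratr q <= r^-1 -> q <= b.
  by move=> leqr; rewrite -(ler_rat R) ratr_int (le_trans leqr) // ceil_ge.
have [s _ supp_s] := left_finite_seq b (lcoef_left_finite G).
have G_close : \forall k \near \oo, forall x : seq_sub s,
    `|G (val x) None - G (val x) (Some k)| < ((r / 2)%:C)%C.
  apply: filter_forall => x.
  by have /cvgrPdist_lt/(_ _ r2_gt0) := @cseqP _ (G (val x)).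
have [N _ GuN] := filterI Gu G_close.
exists N => k /ltnW/GuN[<- close_k].
apply: (@le_lt_trans _ _ (r / 2)); last by lra.
apply: lc_seminorm_le => q leqr; rewrite /lc_sub !lcoef_map distrC -lecR.
rewrite RRe_real ?normr_real //.
have [->|Gq] := eqVneq (G q) 0; first by rewrite subrr normr0 ltW.
by apply/ltW/(close_k (SeqSub (supp_s _ (le_b _ leqr) Gq))).
Qed.

Lemma tame_cvg_dominant m (y : nat -> 'I_m -> LC R[i]) (l : 'I_m -> LC R[i]) i0 :
  (forall i, tame_cvg (y^~ i) (l i)) -> dominant l i0 ->
  \forall k \near \oo, dominant (y k) i0.
Proof.
move=> y_lim [_ l0 lt_l].
have y0_neq0 : \forall k \near \oo, y k i0 0 != 0.
  have := tame_cvg_lt_lcoef0 (tame_cvg_cst (rpred0 valring)) (y_lim i0).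
  rewrite !lcoef0 normr0 normr_gt0 => /(_ l0).
  by apply: filterS => k; rewrite normr_gt0.
have yv : \forall k \near \oo, forall i, y k i \in valring.
  by apply: filter_forall => i; exact: tame_cvg_valring.
have y_lt : \forall k \near \oo, forall i, i != i0 -> `|y k i 0| < `|y k i0 0|.
  apply: filter_forall => i; have [->|/lt_l lt_i] := eqVneq i i0; first exact: nearW.
  by apply: filterS (tame_cvg_lt_lcoef0 (y_lim i) (y_lim i0) lt_i).
by apply: filterS3 y0_neq0 yv y_lt => k; split.
Qed.

Lemma tame_cvg_normalize m (y : nat -> 'I_m -> LC R[i]) (l : 'I_m -> LC R[i]) i0 :
  (forall i, tame_cvg (y^~ i) (l i)) -> dominant l i0 ->
  lc_vec_wk_cvg (fun k => lc_normalize (fun i => lcoef (y k i)))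
                (lc_normalize (fun i => lcoef (l i))).
Proof.
move=> y_lim l_dom; have [lv l0 _] := l_dom.
have abs_lim := tame_cvg_abs (y_lim i0) l0.
have abs_l0 : LCreal (LCabs (l i0)) 0 != 0.
  by rewrite lcoef_real0 lcoef_abs0 ?normr_eq0.
have [t [t_l [t_lim abs_t_l abs_t]]] := tame_cvgV abs_lim abs_l0.
move=> i; rewrite (lc_normalize_dominant l_dom abs_t_l).
apply: lc_wk_cvg_near (tame_cvg_wk (tame_cvgM t_lim (y_lim i))).
apply: filterS2 abs_t (tame_cvg_dominant y_lim l_dom) => k abs_t_k y_dom.
by rewrite (lc_normalize_dominant y_dom abs_t_k).
Qed.

End WeakConvergence.

(** * The power method *)

Section PowerMethod.
Variable R : realType.

Lemma dominant_unique_max m (y : 'I_m -> LC R[i]) i0 :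
  (forall i, y i \in valring) -> (exists i, y i 0 != 0) ->
  unique (fun j => forall i, `|y i 0| <= `|y j 0|) i0 -> dominant y i0.
Proof.
move=> yv [i1 y1] [max_i0 uniq_i0]; split=> // [|i ne_i].
  by rewrite -normr_gt0 (lt_le_trans _ (max_i0 i1)) ?normr_gt0.
rewrite lt_neqAle max_i0 andbT; apply: contraNneq ne_i => eq_max.
by apply/eqP/esym/uniq_i0 => j; rewrite eq_max.
Qed.

Lemma iter_lc_mv_eigen m (J : finType) (A : 'I_m -> 'I_m -> LC R[i])
    (nu : J -> LC R[i]) (w : J -> 'I_m -> LC R[i]) k :
  (forall j i, \sum_l A i l * w j l = nu j * w j i) ->
  iter k (lc_mv (fun i j => lcoef (A i j))) (fun i => lcoef (\sum_j w j i)) =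
  fun i => lcoef (\sum_j nu j ^+ k * w j i).
Proof.
move=> eigen_w; elim: k => [|k IHk].
  by apply/funext => i /=; congr lcoef; apply: eq_bigr => j _; rewrite expr0 mul1r.
rewrite iterS IHk; apply/funext => i.
transitivity (lcoef (\sum_l A i l * \sum_j nu j ^+ k * w j l)).
  by apply/funext => q; rewrite lcoef_sum.
under eq_bigr do rewrite mulr_sumr; rewrite exchange_big /=; congr lcoef.
apply: eq_bigr => j _; rewrite exprSr -mulrA -eigen_w mulr_sumr.
by apply: eq_bigr => l _; rewrite mulrCA.
Qed.

Lemma tame_cvg_sum_expr (I : finType) (mu w : I -> LC R[i]) j0 :
  (forall j, j != j0 -> mu j \in valring /\ `|mu j 0| < 1) ->
  (forall j, w j \in valring) ->
  tame_cvg (fun k => w j0 + \sum_(j | j != j0) mu j ^+ k * w j) (w j0).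
Proof.
move=> mu_small wv.
have term_lim j : j != j0 -> tame_cvg (fun k => mu j ^+ k * w j) (0 * w j).
  move=> /mu_small[muv mu_lt1].
  by apply: tame_cvgM; [exact: tame_cvg_expr|exact: tame_cvg_cst].
have := tame_cvgD (tame_cvg_cst (wv j0)) (tame_cvg_sum (index_enum I) term_lim).
by rewrite [X in _ + X]big1 ?addr0 // => j _; rewrite mul0r.
Qed.

Lemma power_method m (J : finType) (A : 'I_m -> 'I_m -> LC R[i]) (nu : J -> LC R)
    (w : J -> 'I_m -> LC R[i]) j0 i0 :
  (forall j i, \sum_l A i l * w j l = LCreal (nu j) * w j i) ->
  (forall j, nu j \in valring) -> 0 < nu j0 0 ->
  (forall j, j != j0 -> `|nu j 0| < nu j0 0) ->
  (forall j i, w j i \in valring) -> dominant (w j0) i0 ->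
  lc_vec_wk_cvg
    (fun k => lc_normalize (iter k (lc_mv (fun i j => lcoef (A i j)))
                                   (fun i => lcoef (\sum_j w j i))))
    (lc_normalize (fun i => lcoef (w j0 i))).
Proof.
move=> eigen_w nuv nu0_gt0 nu_lt wv w_dom.
have [|nu0V nu0Vv nu0VE] := @LC_inv _ (nu j0) (nu j0 0)^-1 (nuv j0).
  by rewrite divff ?gt_eqF.
have nu0V_lcoef0 : nu0V 0 = (nu j0 0)^-1.
  apply: (mulfI (lt0r_neq0 nu0_gt0)).
  by rewrite -lcoefM0 // nu0VE lcoef1 eqxx divff ?gt_eqF.
pose mu j := LCreal (nu j * nu0V).
have nu_factor j : LCreal (nu j) = LCreal (nu j0) * mu j.
  by rewrite -rmorphM mulrCA nu0VE mulr1.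
have mu_small j : j != j0 -> mu j \in valring /\ `|mu j 0| < 1.
  move=> ne_j; split; first by apply: LCmap_vge; exact: rpredM (nuv j) nu0Vv.
  rewrite lcoef_real0 lcoefM0 // normr_real_complex (ltcR _ 1) nu0V_lcoef0.
  by rewrite normrM normfV (gtr0_norm nu0_gt0) ltr_pdivrMr // mul1r nu_lt.
pose y k i := w j0 i + \sum_(j | j != j0) mu j ^+ k * w j i.
have y_lim i : tame_cvg (y^~ i) (w j0 i) by exact: tame_cvg_sum_expr.
have iterE k :
    iter k (lc_mv (fun i j => lcoef (A i j))) (fun i => lcoef (\sum_j w j i)) =
    fun i => lcoef (LCreal (nu j0 ^+ k) * y k i).
  rewrite (iter_lc_mv_eigen _ eigen_w); apply/funext => i; congr lcoef.
  rewrite (bigD1 j0) //= mulrDr rmorphXn mulr_sumr; congr (_ + _).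
  by apply: eq_bigr => j _; rewrite nu_factor exprMn mulrA.
move=> i; apply: lc_wk_cvg_near (tame_cvg_normalize y_lim w_dom i).
apply: filterS (tame_cvg_dominant y_lim w_dom) => k y_dom.
by rewrite iterE (lc_normalizeZ _ _ y_dom) ?rpredX // lcoefX0 // exprn_gt0.
Qed.

End PowerMethod.
(* The index [ord0] is the paper's index 1. *)
Theorem mainTheorem9 (R : realType) (n : nat)
    (A : lc_mat R n.+1) (nu : 'I_n.+1 -> rat -> R)
    (x : lc_vec R n.+1) (w : 'I_n.+1 -> lc_vec R n.+1) :
  (forall i j, left_finite (A i j)) ->
  (forall i, left_finite (x i)) ->
  (forall j, left_finite (nu j)) ->
  (forall j i, left_finite (w j i)) ->
  lc_diagonalizable A nu ->
  (forall j, at_most_finite (nu j)) ->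
  nu ord0 0 = 1 ->
  (forall j : 'I_n.+1, (0 < j)%N -> `|nu j 0| < 1) ->
  (forall i j : 'I_n.+1, (0 < i <= j)%N -> `|nu j 0| <= `|nu i 0|) ->
  (forall i, x i = (fun q => \sum_(j < n.+1) w j i q)) ->
  (forall j, lc_mv A (w j) = lc_vscale (lc_RC (nu j)) (w j)) ->
  (forall j i, at_most_finite (w j i)) ->
  (exists i, w ord0 i 0 != 0) ->
  (exists! i0 : 'I_n.+1, forall i, `|w ord0 i 0| <= `|w ord0 i0 0|) ->
  lc_vec_wk_cvg
    (fun k => lc_vscale (lc_inv (lc_RC (lc_maxnorm (iter k (lc_mv A) x))))
                        (iter k (lc_mv A) x))
    (lc_vscale (lc_inv (lc_RC (lc_maxnorm (w ord0)))) (w ord0)).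
Proof.
move=> fA _ fnu fw _ nuv nu0 nu_lt1 _ xw eigen_w wv w_neq0 [i0 max_i0].
pose A' i j := toLC (fA i j); pose nu' j := toLC (fnu j).
pose w' j i := toLC (fw j i).
have eigen_w' j i : \sum_l A' i l * w' j l = LCreal (nu' j) * w' j i.
  apply: LC_ext => q; rewrite lcoef_sum.
  exact: (congr1 (fun f => f i q) (eigen_w j)).
have -> : x = fun i => lcoef (\sum_j w' j i).
  by apply/funext => i; rewrite xw; apply/funext => q; rewrite lcoef_sum.
apply: (power_method eigen_w' (j0 := ord0) (i0 := i0)).
- by move=> j; apply/vgeP/nuv.
- by rewrite /= nu0.
- by move=> j; rewrite /= nu0 -lt0n; apply: nu_lt1.
- by move=> j i; apply/vgeP/wv.
- by apply: (@dominant_unique_max _ _ (w' ord0)) => // i; apply/vgeP/wv.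
Qed.
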